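(* Let $\mathcal{C}$ be the class of finite unary forests with edges labeled by $0$ and $1$. Then $\mathcal{C}$ obeys the geometric zero-one law, but $\mathcal{C}$ obeys neither the labeled zero-one law nor the unlabeled zero-one law.
   Context: The vocabulary $\Upsilon$ consists of two binary relation symbols $E_0,E_1$, one for each edge label; sentences are first-order $\Upsilon$-sentences. A unary forest is a directed graph in which each vertex has at most one incoming edge and at most one outgoing edge and each of whose connected components is a (finite or infinite) directed path (a single vertex counts as a path; directed cycles are not allowed). A unary forest with edges labeled by $0$ and $1$ is a unary forest in which each edge carries exactly one label $0$ or $1$, viewed as an $\Upsilon$-structure in which $E_i(x,y)$ holds iff there is an edge from $x$ to $y$ with label $i$. $\mathcal{C}$ is the class of all finite such structures. Labeled zero-one law for $\mathcal{C}$: for every sentence $\phi$, the fraction of structures in $\mathcal{C}$ with universe $\{1,\ldots,n\}$ that satisfy $\phi$ tends to $0$ or to $1$ as $n\to\infty$. Unlabeled zero-one law for $\mathcal{C}$: for every sentence $\phi$, the fraction of isomorphism classes of $n$-element structures in $\mathcal{C}$ whose members satisfy $\phi$ tends to $0$ or to $1$ as $n\to\infty$. Geometric zero-one law for $\mathcal{C}$: there is an infinite connected structure $X$ of bounded degree with the duplicate substructure property such that $\mathcal{C}$ is the class of all structures isomorphic to finite substructures of $X$, and every sentence is either almost surely true or almost surely false for finite substructures of $X$. Here: - A substructure is the induced substructure on a subset of elements (the empty subset is allowed). - The Gaifman graph $[X]$ has the elements of $X$ as vertices, distinct elements being adjacent iff they occur together in a tuple satisfying a relation of $X$. Connectedness,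 bounded degree (uniformly bounded vertex degrees) and distance refer to $[X]$, and $B_n(x)$ is the substructure supported by the elements at distance at most $n$ from $x$. - $X$ has the duplicate substructure property if for every finite substructure there is an isomorphic substructure having no element in common with it and no edge of $[X]$ to it. - A sentence is almost surely true (resp. false) for finite substructures of $X$ if for every $x\in X$ the fraction of substructures of $B_n(x)$ satisfying it approaches $1$ (resp. $0$) as $n\to\infty$. *)

(* Defs.v *)
From Stdlib Require Import Relation_Operators.
From mathcomp Require Import all_boot all_order all_algebra finmap.
From mathcomp Require Import all_classical all_reals all_analysis.

Set Implicit Arguments.
Unset Strict Implicit.
Unset Printing Implicit Defensive.

Import Order.TTheory GRing.Theory Num.Theory.
Import numFieldNormedType.Exports.

Local Open Scope classical_set_scope.
Local Open Scope ring_scope.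

(* The vocabulary has two binary relation symbols [E_0] and [E_1]; the edge
   labels 0 and 1 are represented by [false] and [true]. *)
Record structure := Structure {
  carrier :> Type;
  edge_lab : bool -> carrier -> carrier -> Prop
}.

Definition substructure (S : structure) (A : set S) : structure :=
  @Structure {x : S | A x} (fun i x y => edge_lab i (sval x) (sval y)).

Definition isomorphic (S T : structure) : Prop :=
  exists2 f : S -> T, bijective f &
    forall i x y, edge_lab i x y <-> edge_lab i (f x) (f y).

(* [formula n] is the type of first-order formulas with equality whose free
   variables are among [n] de Bruijn variables. The index 0 in the body of
   [FAll] is the bound variable. The omitted connectives are definable, since
   satisfaction is interpreted classically. *)
Inductive formula : nat -> Type :=
| FBot n : formula n
| FEq n : 'I_n -> 'I_n -> formula n
| FEdge n : bool -> 'I_n -> 'I_n -> formula n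
| FImp n : formula n -> formula n -> formula n
| FAll n : formula n.+1 -> formula n.

Definition sentence := formula 0.

Definition env_cons (T : Type) n (a : T) (v : 'I_n -> T) : 'I_n.+1 -> T :=
  fun i => if unlift ord0 i is Some j then v j else a.

Definition env_nil (T : Type) : 'I_0 -> T :=
  fun i => False_rect T (notF (ltn_ord i)).

Fixpoint sat (S : structure) n (p : formula n) : ('I_n -> S) -> Prop :=
  match p in formula m return ('I_m -> S) -> Prop with
  | FBot _ => fun _ => False
  | FEq _ i j => fun v => v i = v j
  | FEdge _ b i j => fun v => edge_lab b (v i) (v j)
  | FImp _ p q => fun v => sat p v -> sat q v
  | FAll _ p => fun v => forall a : S, sat p (env_cons a v)
  end.

Definition models (S : structure) (phi : sentence) : Prop :=
  sat phi (@env_nil S).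

Definition component (T : Type) (e : T -> T -> Prop) (x : T) : set T :=
  [set y | clos_refl_sym_trans T e x y].

(* A directed path, finite or infinite in either direction, is a copy of an
   interval of the integers with an edge from each [k] to [k + 1]. *)
Definition directed_path (T : Type) (e : T -> T -> Prop) (D : set T) : Prop :=
  exists f : T -> int,
    [/\ forall x y, D x -> D y -> f x = f y -> x = y,
        is_interval (f @` D) &
        forall x y, D x -> D y -> (e x y <-> f y = f x + 1)].

Definition unary_forest (T : Type) (e : T -> T -> Prop) : Prop :=
  [/\ forall x y z, e x z -> e y z -> x = y,
      forall x y z, e x y -> e x z -> y = z &
      forall x, directed_path e (component e x)].

Definition labeled_unary_forest (S : structure) : Prop :=
  unary_forest (fun x y : S => exists i, edge_lab i x y) /\
  forall x y : S, ~ (edge_lab false x y /\ edge_lab true x y).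

Definition finite_labeled_unary_forest (S : structure) : Prop :=
  finite_set [set: S] /\ labeled_unary_forest S.

(* The universe {1, ..., n} is represented by ['I_n]. *)
Definition str_on n := {ffun bool * 'I_n * 'I_n -> bool}.

Definition structure_of n (r : str_on n) : structure :=
  @Structure 'I_n (fun i x y => r (i, x, y)).

Definition class_on (C : structure -> Prop) n : {set str_on n} :=
  [set r | `[< C (structure_of r) >]]%SET.

Definition zero_or_one (R : realType) (u : nat -> R) : Prop :=
  u @ \oo --> (0 : R) \/ u @ \oo --> (1 : R).

Definition labeled_fraction (R : realType) (C : structure -> Prop)
    (phi : sentence) (n : nat) : R :=
  #|[set r in class_on C n | `[< models (structure_of r) phi >]]%SET|%:R
    / #|class_on C n|%:R.

Definition labeled_zero_one_law (R : realType) (C : structure -> Prop) : Prop :=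
  forall phi : sentence, zero_or_one (labeled_fraction R C phi).

(* Every [n]-element structure is isomorphic to one with universe ['I_n], so an
   isomorphism class is given by its members with universe ['I_n]. *)
Definition iso_classes (C : structure -> Prop) n : {set {set str_on n}} :=
  equivalence_partition
    (fun r s => `[< isomorphic (structure_of r) (structure_of s) >])
    (class_on C n).

Definition unlabeled_fraction (R : realType) (C : structure -> Prop)
    (phi : sentence) (n : nat) : R :=
  #|[set K in iso_classes C n |
      [forall r in K, `[< models (structure_of r) phi >]]]%SET|%:R
    / #|iso_classes C n|%:R.

Definition unlabeled_zero_one_law (R : realType) (C : structure -> Prop) :
    Prop :=
  forall phi : sentence, zero_or_one (unlabeled_fraction R C phi).

Definition gaifman (X : structure) (x y : X) : Prop :=
  x <> y /\ exists i, edge_lab i x y \/ edge_lab i y x.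

Definition gaifman_connected (X : structure) : Prop :=
  forall x y : X, component (@gaifman X) x y.

Definition bounded_degree (X : structure) : Prop :=
  exists d : nat, forall x : X, ([set y | gaifman x y] #<= `I_d)%card.

Fixpoint walk (X : structure) (k : nat) (x y : X) : Prop :=
  if k is k'.+1 then exists2 z, gaifman x z & walk k' z y else x = y.

Definition gball (X : structure) (n : nat) (x : X) : set X :=
  [set y | exists2 k, (k <= n)%N & walk k x y].

Definition duplicate_substructure (X : structure) : Prop :=
  forall A : set X, finite_set A ->
    exists B : set X,
      [/\ isomorphic (substructure A) (substructure B),
          A `&` B = set0 &
          forall a b, A a -> B b -> ~ gaifman a b].

(* Substructures are counted as subsets, not up to isomorphism. In a structure
   of bounded degree the balls are finite, so both sets below are finite and
   [fset_set] has its intended value. *)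
Definition ball_fraction (R : realType) (X : structure) (phi : sentence)
    (x : X) (n : nat) : R :=
  #|` fset_set [set A : set X | A `<=` gball n x /\ models (substructure A) phi]|%:R
    / #|` fset_set [set A : set X | A `<=` gball n x]|%:R.

Definition almost_surely_true (R : realType) (X : structure) (phi : sentence) :
    Prop :=
  forall x : X, ball_fraction R phi x @ \oo --> (1 : R).

Definition almost_surely_false (R : realType) (X : structure)
    (phi : sentence) : Prop :=
  forall x : X, ball_fraction R phi x @ \oo --> (0 : R).

Definition geometric_zero_one_law (R : realType) (C : structure -> Prop) :
    Prop :=
  exists X : structure,
    [/\ infinite_set [set: X] /\ gaifman_connected X,
        bounded_degree X,
        duplicate_substructure X,
        (forall S : structure,
           C S <-> exists2 A : set X, finite_set A & isomorphic S (substructure A)) &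
        forall phi : sentence,
          almost_surely_true R X phi \/ almost_surely_false R X phi].

(* Main.v *)
(* The ambient structure is the line of integers, the edge from [k] to [k + 1]
   being labeled by a bi-infinite word in which every finite word occurs
   arbitrarily far to the right. A substructure on [A] is a colouring of the
   line by (membership in [A], label). If two such colourings contain every
   window of radius [2 ^ k] away from any [k] given points, the duplicator wins
   the [k]-round game, so the two substructures satisfy the same sentences of
   rank [k]. One finite pattern forces this richness; it can occur at
   infinitely many disjoint places, so a random subset of a large ball almost
   surely contains it.

   The labeled and unlabeled laws both fail for "there is an isolated vertex".
   Let [a n] be the number of forests divided by [n!], or the number of
   isomorphism classes, and [h n] the same count for the forests with an
   isolated vertex. Removing or inserting an isolated vertex gives
   [a n - h n <= h n.+1 <= a n]. If [h / a] tended to 0, then [a] would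
   eventually grow by a factor 5 at each step, and if it tended to 1, by a
   factor of at most 3/2; but [2 ^ (n - 1) <= a n <= 4 ^ n]. *)

From Stdlib Require Import Relation_Operators.
Require Import Defs.
From mathcomp Require Import all_boot all_order all_algebra.
From mathcomp Require Import finmap perm zify ring lra.
From mathcomp Require Import all_classical all_reals all_analysis.

Set Implicit Arguments.
Unset Strict Implicit.
Unset Printing Implicit Defensive.

Import Order.TTheory GRing.Theory Num.Theory.
Import numFieldNormedType.Exports.

Local Open Scope classical_set_scope.
Local Open Scope ring_scope.

(** * Rich colourings of the line and the back-and-forth game *)

Definition line (l : int -> bool) : structure :=
  @Structure int (fun i x y => y = x + 1 /\ l x = i).

Local Notation line_sub l A := (@substructure (line l) A).

Definition colouring (l : int -> bool) (A : set int) (x : int) : bool * bool :=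
  (`[< A x >], l x).

(** Only the values of [u] on the window of radius [r] matter, so [u] stands for an arbitrary window
    colouring; the [v i] are the points already chosen in the game. *)
Definition rich (c : int -> bool * bool) (N r : nat) : Prop :=
  forall (u : int -> bool * bool) n (v : 'I_n -> int), (n <= N)%N ->
  exists p : int, (forall d : int, (`|d| <= r)%N -> c (p + d) = u d) /\
    forall i, (r < `|p - v i|)%N.

Lemma rich_le c N r s : (s <= r)%N -> rich c N r -> rich c N s.
Proof.
move=> sr cr u n v nN; have [p [pu pv]] := cr u n v nN.
exists p; split=> [d ds|i]; first exact/pu/(leq_trans ds).
exact: leq_ltn_trans (pv i).
Qed.

(** The invariant of the game: corresponding points see the same colours up to distance [r], and
    displacements of size at most [r] are preserved. Of points further apart it is only required
    that they stay further apart. *)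
Definition agree (c c' : int -> bool * bool) (r n : nat) (v v' : 'I_n -> int) :=
  (forall i (d : int), (`|d| <= r)%N -> c (v i + d) = c' (v' i + d)) /\
  (forall i j (d : int), (`|d| <= r)%N -> v j = v i + d <-> v' j = v' i + d).

Lemma agree_le c c' r s n (v v' : 'I_n -> int) : (s <= r)%N ->
  agree c c' r v v' -> agree c c' s v v'.
Proof.
by move=> sr [h1 h2]; split=> [i d|i j d] ds; [apply: h1|apply: h2];
  apply: leq_trans ds sr.
Qed.

Lemma agreeC c c' r n (v v' : 'I_n -> int) :
  agree c c' r v v' -> agree c' c r v' v.
Proof.
by move=> [h1 h2]; split=> [i d|i j d] dr; [rewrite h1|apply: iff_sym; apply: h2].
Qed.

Lemma env_cons0 T n (a : T) (v : 'I_n -> T) : env_cons a v ord0 = a.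
Proof. by rewrite /env_cons unlift_none. Qed.

Lemma env_consS T n (a : T) (v : 'I_n -> T) i : env_cons a v (lift ord0 i) = v i.
Proof. by rewrite /env_cons liftK. Qed.

Lemma agree_cons c c' r n (v v' : 'I_n -> int) (a b : int) :
  agree c c' r v v' ->
  (forall d : int, (`|d| <= r)%N -> c (a + d) = c' (b + d)) ->
  (forall i (d : int), (`|d| <= r)%N -> v i = a + d <-> v' i = b + d) ->
  agree c c' r (env_cons a v) (env_cons b v').
Proof.
move=> [h1 h2] hc hd; split=> [i d dr|i j d dr].
  by case: (unliftP ord0 i) => [k ->|->]; rewrite ?env_consS ?env_cons0; auto.
case: (unliftP ord0 i) => [k ->|->]; case: (unliftP ord0 j) => [m ->|->];
  rewrite ?env_consS ?env_cons0; auto; last by lia.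
by have := hd k (- d) ltac:(lia); lia.
Qed.

(** One round costs half the radius. A point within [r] of some [v i] is answered at the same
    displacement from [v' i], its window lying in the known one of radius [r + r]; a distant point
    is answered by a copy of its window far from all [v' i]. *)
Lemma agree_extend c c' N r n (v v' : 'I_n -> int) (a : int) : (n <= N)%N ->
  rich c' N r -> agree c c' (r + r) v v' ->
  exists b, c a = c' b /\ agree c c' r (env_cons a v) (env_cons b v').
Proof.
move=> nN rich' ag; have [h1 h2] := ag.
have [[i ai]|far] := pselect (exists i, (`|a - v i| <= r)%N).
  have hc (d : int) : (`|d| <= r)%N -> c (a + d) = c' (v' i + (a - v i) + d).
    by move=> dr; rewrite -addrA -h1; [congr c|]; lia.
  exists (v' i + (a - v i)); split.
    by have := hc 0 ltac:(lia); rewrite !addr0.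
  apply: agree_cons => // [|j d dr]; first by apply: agree_le ag; lia.
  by have := h2 i j (a - v i + d) ltac:(lia); lia.
have [b [bc bv]] := rich' (fun d => c (a + d)) n v' nN.
exists b; split; first by have := bc 0 ltac:(lia); rewrite !addr0.
apply: agree_cons => [|d dr|i d dr]; first by apply: agree_le ag; lia.
  by rewrite bc.
have := bv i; have : ~ (`|a - v i| <= r)%N by move=> h; apply: far; exists i.
by lia.
Qed.

Fixpoint qrank n (p : formula n) : nat :=
  match p with
  | FImp _ p q => maxn (qrank p) (qrank q)
  | FAll _ p => (qrank p).+1
  | _ => 0
  end.

(** Here [k] bounds the nested quantifiers still to be played and [N] the points on the board at the
    end. Equality is displacement 0; an edge is displacement 1 together with the label part of the
    colour. Both are visible because [2 ^ k] is at least 1. *)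
Lemma agree_sat (l : int -> bool) (A B : set int) n (p : formula n) :
  forall k N (v : 'I_n -> line_sub l A) (v' : 'I_n -> line_sub l B),
  (qrank p <= k)%N -> (n + k <= N)%N ->
  rich (colouring l A) N (2 ^ k) -> rich (colouring l B) N (2 ^ k) ->
  agree (colouring l A) (colouring l B) (2 ^ k)
    (fun i => sval (v i)) (fun i => sval (v' i)) ->
  sat p v <-> sat p v'.
Proof.
elim: p => {n} [n|n i j|n b i j|n p IHp q IHq|n p IHp] k N v v' //=.
- move=> _ _ _ _ [_ /(_ j i 0) h]; rewrite !addr0 in h.
  by split=> e; apply: eq_sig_hprop => [x ? ?|];
    try exact: Prop_irrelevance; apply/h; rewrite ?e.
- move=> _ _ _ _ [/(_ i 0) h1 /(_ i j 1) h2].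
  rewrite h2; last by rewrite expn_gt0.
  by have := h1 ltac:(lia); rewrite !addr0 => -[_ ->].
- rewrite geq_max => /andP[pk qk] nN rA rB ag.
  by rewrite (IHp k N v v') // (IHq k N v v').
case: k => // k; rewrite ltnS => pk nN rA rB ag.
have lek : (2 ^ k <= 2 ^ k.+1)%N by rewrite leq_pexp2l.
(* Stated for arbitrary [C] and [D], to serve both directions of the quantifier case. *)
have h (C D : set int) (c : 'I_n -> line_sub l C) (d : 'I_n -> line_sub l D)
    (x : line_sub l C) :
    rich (colouring l D) N (2 ^ k) ->
    agree (colouring l C) (colouring l D) (2 ^ k.+1)
      (fun i => sval (c i)) (fun i => sval (d i)) ->
    exists y : line_sub l D, agree (colouring l C) (colouring l D) (2 ^ k)
      (fun i => sval (env_cons x c i)) (fun i => sval (env_cons y d i)).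
  move=> rD agr.
  have E T (Q : set T) m (z : {t | Q t}) (e : 'I_m -> {t | Q t}) :
      (fun i => sval (env_cons z e i)) = env_cons (sval z) (fun i => sval (e i)).
    by apply/funext => i; rewrite /env_cons; case: unlift.
  rewrite expnS mul2n -addnn in agr.
  have [|y [cy agy]] := agree_extend (sval x) _ rD agr; first by lia.
  (* Membership is part of the colour, so the answer to a point of [C] lies in [D]. *)
  have Dy : D y.
    have Cx : C (sval x) := svalP x.
    by case: cy => + _; rewrite asboolT // => /esym/asboolP.
  by exists (exist _ y Dy); rewrite !E.
split=> H x.
  have [y agy] := h _ _ v' v x (rich_le lek rA) (agreeC ag).
  by apply/(IHp k N _ _ _ _ _ _ (agreeC agy))/H => //; rewrite ?addSnnS//;
    exact: rich_le lek _.
have [y agy] := h _ _ v v' x (rich_le lek rB) ag.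
by apply/(IHp k N _ _ _ _ _ _ agy)/H => //; rewrite ?addSnnS//; exact: rich_le lek _.
Qed.

Lemma rich_models (l : int -> bool) (A B : set int) (phi : sentence) :
  rich (colouring l A) (qrank phi) (2 ^ qrank phi) ->
  rich (colouring l B) (qrank phi) (2 ^ qrank phi) ->
  models (line_sub l A) phi <-> models (line_sub l B) phi.
Proof.
move=> rA rB; apply: agree_sat rA rB _ => //.
by split=> [[]|[]].
Qed.

(** * Labeled unary forests as substructures of a line *)

Definition embeds (l : int -> bool) (S : structure) : Prop :=
  exists2 g : S -> int, injective g &
    forall i x y, edge_lab i x y <-> g y = g x + 1 /\ l (g x) = i.

Lemma embeds_forest l S : embeds l S -> labeled_unary_forest S.
Proof.
move=> [g gI ge]; split; last by move=> x y [/ge[_ +] /ge[_ +]] => ->.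
have ee (x y : S) : (exists i, edge_lab i x y) <-> g y = g x + 1.
  by split=> [[i /ge[]//]|h]; exists (l (g x)); apply/ge.
split=> [x y z /ee + /ee|x y z /ee + /ee|x].
- by move=> -> /addIr/esym/gI.
- by move=> + exz; rewrite -exz => /gI.
exists g; split=> [y z _ _ /gI//||y z _ _]; last exact: ee.
set e := fun _ _ => _ in ee *.
(* A discrete intermediate value property: each edge changes [g] by one, so a chain from [y] to [z]
   visits every integer between [g y] and [g z]. *)
have between (y z : S) (k : int) : component e y z ->
    (g y <= k <= g z) \/ (g z <= k <= g y) -> exists2 t, component e y t & g t = k.
  rewrite /component /=.
  elim=> {y z} [y z /[dup] eyz /ee h|y|y z yz IH|y z t yz IHz zt IHt] gk.
  - have [->|->] : k = g y \/ k = g z by lia.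
      by exists y => //; exact: rst_refl.
    by exists z => //; exact: rst_step.
  - by exists y; [exact: rst_refl|lia].
  - have [t yt tk] := IH ltac:(lia).
    by exists t => //; apply: rst_trans yt; exact: rst_sym.
  - have [/IHz//|h] := pselect ((g y <= k <= g z) \/ (g z <= k <= g y)).
    have [u zu uk] := IHt ltac:(lia).
    by exists u => //; apply: rst_trans zu.
move=> _ _ [y xy <-] [z xz <-] k yk.
have [] := between y z k _ (or_introl yk).
  by apply: rst_trans xz; exact: rst_sym.
by move=> t yt tk; exists t => //; apply: rst_trans yt.
Qed.

Lemma embedding_isomorphic (S X : structure) (g : S -> X) : injective g ->
  (forall i x y, edge_lab i x y <-> edge_lab i (g x) (g y)) ->
  isomorphic S (substructure (range g)).
Proof.
move=> gI ge; exists (fun x => exist _ (g x) (ex_intro2 _ _ x I erefl)) => //.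
have inv (y : substructure (range g)) : {x : S | g x = sval y}.
  by apply: cid; case: y => /= _ [x _ <-]; exists x.
exists (fun y => sval (inv y)) => [x|y].
  by apply: gI; case: (inv _).
case: (inv y) => x /= xy; exact: eq_sig_hprop.
Qed.

Lemma finite_bounded (T : Type) (g : T -> int) : finite_set [set: T] ->
  exists K, forall x, (`|g x| <= K)%N.
Proof.
move=> /(@finite_seqP {classic T})[s sT].
have {sT} : forall x, x \in (s : seq {classic T}).
  by move=> x; have : [set: T] x by []; rewrite sT.
have h : exists K, forall x : {classic T}, x \in s -> (`|g x| <= K)%N.
  elim: s => [|x s [K IH]]; first by exists 0%N.
  exists (maxn `|g x| K) => y; rewrite inE leq_max => /predU1P[->|/IH ->].
    by rewrite leqnn.
  by rewrite orbT.
by case: h => K h inS; exists K => x; exact: h.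
Qed.

Definition recurrent (w : int -> bool) : Prop :=
  forall (u : nat -> bool) L (N : int),
    exists2 p : int, N <= p & forall i : nat, (i < L)%N -> w (p + i%:Z) = u i.

(** Induction on a list [s] of vertices, embedding the union [D s] of their components; the
    component of a new vertex is either contained in this union or disjoint from it. *)
Lemma forest_embeds w S : recurrent w -> finite_labeled_unary_forest S -> embeds w S.
Proof.
move=> wrec [finS [[ein eout epath] elab]].
set e := (fun x y : S => _) in ein eout epath.
pose D (s : seq {classic S}) (y : S) :=
  exists2 x : {classic S}, x \in s & component e x y.
suff H (s : seq {classic S}) : exists2 g : S -> int,
    (forall y z, D s y -> D s z -> g y = g z -> y = z) &
    forall i y z, D s y -> D s z ->
      edge_lab i y z <-> g z = g y + 1 /\ w (g y) = i.
  have /(@finite_seqP {classic S})[s sT] := finS.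
  have Ds x : D s x.
    exists x; last exact: rst_refl.
    by have : [set: S] x by []; rewrite sT.
  by have [g gI ge] := H s; exists g => [x y|i x y]; [apply: gI|apply: ge].
elim: s => [|x s [g gI ge]]; first by exists (fun=> 0) => [y z []|i y z []].
have [Dx|nDx] := pselect (D s x).
  have DD y : D (x :: s) y -> D s y.
    move=> [z]; rewrite inE => /predU1P[->|zs] zy; last by exists z.
    by have [t ts tx] := Dx; exists t => //; exact: rst_trans zy.
  by exists g => [y z /DD + /DD|i y z /DD + /DD]; [exact: gI|exact: ge].
have DC y : D s y -> ~ component e x y.
  move=> [t ts ty] xy; apply: nDx; exists t => //.
  by apply: rst_trans ty _; exact: rst_sym.
have DE y : D (x :: s) y -> component e x y \/ (D s y /\ ~ component e x y).
  move=> [z]; rewrite inE => /predU1P[->|zs] zy; first by left.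
  by right; split; [|apply: DC]; exists z.
have [f [fI _ fe]] := epath x.
have [K Kf] := finite_bounded f finS.
have [M Mg] := finite_bounded g finS.
(* The label word of the component, shifted by [K] so as to start at index 0. Positions without an
   outgoing edge get [false], where any label would do. *)
pose u (k : nat) := `[< exists y z,
  [/\ component e x y, f y = k%:Z - K%:Z & edge_lab true y z] >].
(* Old vertices lie at or before [M]; starting at [M + 2] or later leaves a gap that excludes edges
   between old and new vertices. *)
have [p Mp pu] := wrec u (K + K).+1 (M%:Z + 2).
(* The component of [x] is placed to the right of everything placed so far,
   where [w] reads its labels. *)
pose g' y : int := if `[< component e x y >] then p + (f y + K%:Z) else g y.
have g'C y : component e x y -> g' y = p + (f y + K%:Z) by rewrite /g' => /asboolT ->.
have g'D y : ~ component e x y -> g' y = g y by rewrite /g' => /asboolF ->.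
have wu y i z : component e x y -> edge_lab i y z -> w (g' y) = i.
  move=> xy yz; rewrite g'C //.
  have -> : f y + K%:Z = (absz (f y + K%:Z))%:Z by have := Kf y; lia.
  rewrite pu; last by have := Kf y; lia.
  rewrite /u; case: i yz => yz.
    by apply/asboolT; exists y, z; split=> //; have := Kf y; lia.
  apply/asboolF => -[y' [z' [xy' fy' yz']]].
  have yy' : y' = y by apply: fI => //; have := Kf y; lia.
  subst y'; have zz' : z' = z by apply: eout; [exists true; exact: yz'|exists false].
  by subst z'; apply: (elab y z).
have cross i y z : edge_lab i y z -> component e x y <-> component e x z.
  move=> yz; have yz' : clos_refl_sym_trans S e y z by apply: rst_step; exists i.
  by split=> h; apply: rst_trans h _ => //; exact: rst_sym.
exists g' => [y z /DE hy /DE hz|i y z /DE hy /DE hz].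
  have := Kf y; have := Kf z; have := Mg y; have := Mg z.
  case: hy => [xy|[Dy xy]]; case: hz => [xz|[Dz xz]];
    rewrite ?(g'C y xy) ?(g'C z xz) ?(g'D y xy) ?(g'D z xz); try lia.
    by move=> _ _ _ _ h; apply: fI => //; lia.
  by move=> _ _ _ _; exact: gI.
case: hy => [xy|[Dy xy]]; case: hz => [xz|[Dz xz]].
- split=> [yz|[h wi]].
    split; last exact: wu yz.
    by have /(fe y z xy xz) : e y z; [exists i|rewrite !g'C//; lia].
  have [j yz] : e y z by apply/(fe y z xy xz); move: h; rewrite !g'C//; lia.
  by rewrite -wi (wu _ _ _ xy yz).
- split=> [/cross yz|]; first by case: xz; apply/yz.
  by rewrite (g'C y xy) (g'D z xz); have := Kf y; have := Mg z; lia.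
- split=> [/cross yz|]; first by case: xy; apply/yz.
  by rewrite (g'C z xz) (g'D y xy); have := Kf z; have := Mg y; lia.
by rewrite (g'D y xy) (g'D z xz); exact: ge.
Qed.

Lemma injective_unbounded (f : nat -> nat) B : injective f -> exists j, (B <= f j)%N.
Proof.
move=> fI; apply: contrapT => /forallNP h.
have fB (j : 'I_B.+1) : (f j < B)%N by rewrite ltnNge; apply/negP/h.
have /leq_card : injective (fun j => Ordinal (fB j)).
  by move=> i j /(congr1 val)/= /fI/val_inj.
by rewrite !card_ord ltnn.
Qed.

Lemma recurrent_word : exists w, recurrent w.
Proof.
pose block (m : nat) : seq bool :=
  (odflt ([::], 0%N) (choice.unpickle m)).1.
(* The [m]-th word is written from position [2 ^ m] on; the index [j] below
   makes each word come up infinitely often. *)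
exists (fun k => if k is Posz j then
  nth false (block (trunc_log 2 j)) (j - 2 ^ trunc_log 2 j) else false) => u L N.
(* Distinct [j] give distinct codes [m] of the same word, so [m] can be taken at least [|N|] and
   [L]: then [2 ^ m] is beyond [N], and the word ends before [2 ^ m.+1]. *)
have [|j] := @injective_unbounded (fun j => choice.pickle (mkseq u L, j)) (maxn `|N| L).
  by move=> i j /(pcan_inj choice.pickleK)[].
set m := choice.pickle _; rewrite geq_max => /andP[Nm Lm].
have m2 : (m < 2 ^ m)%N by exact: ltn_expl.
exists (2 ^ m)%N => [|i iL]; first by lia.
rewrite -PoszD (@trunc_log_eq 2 m) //; last first.
  by rewrite expnS; apply/andP; split; lia.
by rewrite addKn /block choice.pickleK /= nth_mkseq.
Qed.

(** * The Gaifman graph of the line and its finite substructures *)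

Lemma gaifman_line l (x y : line l) :
  gaifman x y <-> y = x + 1 :> int \/ x = y + 1 :> int.
Proof.
split=> [[_ [i [[-> _]|[-> _]]]]|]; [by left|by right|].
case=> ->; split.
- by move=> h; have : (x : int) = x + 1 by []; lia.
- by exists (l x); left.
- by move=> h; have : (y : int) = y + 1 by []; lia.
- by exists (l y); right.
Qed.

Lemma gball_line l n (x : line l) :
  gball n x = [set y : int | (`|y - (x : int)| <= n)%N].
Proof.
apply/seteqP; split=> y /=.
  move=> [k kn xy]; apply: leq_trans kn.
  elim: k x xy => [x <-|k IH x [z /gaifman_line xz /IH]]; first by rewrite subrr.
  by case: xz => h; lia.
move=> h; exists (`|y - (x : int)|)%N => //.
elim: n x h => [|n IH] x h.
  have -> : y = x by move: h; rewrite leqn0 absz_eq0 subr_eq0 => /eqP.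
  by rewrite subrr.
have [|xy] := leqP `|y - (x : int)| n; first exact: IH.
have -> : `|y - (x : int)|%N = n.+1 by lia.
have [lt|le] := ltP (x : int) y.
  exists (x + 1); first by apply/gaifman_line; left.
  by have := IH (x + 1) ltac:(lia); have -> : absz (y - (x + 1))%R = n by lia.
exists (x - 1); first by apply/gaifman_line; right; rewrite subrK.
by have := IH (x - 1) ltac:(lia); have -> : absz (y - (x - 1))%R = n by lia.
Qed.

Lemma walk_component (X : structure) k (x y : X) :
  walk k x y -> component (@gaifman X) x y.
Proof.
elim: k x => [x ->|k IH x [z xz /IH zy]]; first exact: rst_refl.
by apply: rst_trans zy; apply: rst_step.
Qed.

Lemma line_connected l : gaifman_connected (line l).
Proof.
move=> x y; have : gball `|(y : int) - (x : int)| x y by rewrite gball_line /=.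
by case=> k _ /walk_component.
Qed.

Lemma line_bounded_degree l : bounded_degree (line l).
Proof.
exists 2%N => x; pose f (i : nat) : line l := if i is 0%N then x + 1 else x - 1.
apply: card_le_trans (card_image_le f `I_2); apply: subset_card_le => y.
by case/gaifman_line => h; [exists 0%N|exists 1%N] => //=; lia.
Qed.

Lemma line_infinite l : infinite_set [set: line l].
Proof. by move=> /(finite_bounded (fun x => x : int))[K /(_ (K%:Z + 1))]; lia. Qed.

Lemma finite_set_bounded (A : set int) : finite_set A ->
  exists K, forall x, A x -> (`|x| <= K)%N.
Proof.
move=> /finite_seqP[s ->].
exists (\max_(x <- s) `|x|)%N => x /= xs.
by rewrite (big_rem x xs) /= leq_maxl.
Qed.

Lemma line_duplicate w : recurrent w -> duplicate_substructure (line w).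
Proof.
move=> wrec A /finite_set_bounded[K AK].
(* The labels on [[-K, K]] recur from [p] on; translating [A] by [p + K] preserves them and leaves a
   distance of at least 2 from [A]. *)
have [p Kp pu] := wrec (fun i => w (i%:Z - K%:Z)) (K + K).+1 (K%:Z + 2).
pose g (x : substructure A) : line w := (sval x : int) + (p + K%:Z).
have gA y : range g y -> exists2 x : int, A x & (y : int) = x + (p + K%:Z).
  by move=> [x _ <-]; exists (sval x) => //; exact: svalP.
exists (range g); split.
- apply: embedding_isomorphic => [x y /addIr|i x y]; first exact: eq_sig_hprop.
  have wx : w (g x) = w (sval x).
    have Kx := AK _ (svalP x); have := pu (absz ((sval x : int) + K%:Z)%R) ltac:(lia).
    have -> : (absz ((sval x : int) + K%:Z)%R)%:Z = (sval x : int) + K%:Z by lia.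
    by rewrite addrK => <-; congr w; rewrite /g; lia.
  rewrite /= wx /g; split=> [[-> ->]|[h ->]]; first by rewrite addrAC.
  by split=> //; apply: (addIr (p + K%:Z)); rewrite h addrAC.
- apply/seteqP; split=> // y [Ay /gA[x Ax yx]].
  by exfalso; have := AK _ Ay; have := AK _ Ax; lia.
- move=> a b Aa /gA[x Ax bx] /gaifman_line.
  by have := AK _ Aa; have := AK _ Ax; lia.
Qed.

Lemma isomorphic_embeds l S (A : set (line l)) :
  isomorphic S (substructure A) -> embeds l S.
Proof.
move=> [f fb fe]; exists (fun x => sval (f x)) => [x y|i x y]; last exact: fe.
by move=> /eq_sig_hprop h; apply: (bij_inj fb); exact: h.
Qed.

Lemma isomorphic_finite S (X : structure) (A : set X) : finite_set A ->
  isomorphic S (substructure A) -> finite_set [set: S].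
Proof.
move=> fA [f fb _].
have -> : [set: S] = (fun x => sval (f x)) @^-1` A.
  by apply/seteqP; split=> x // _; exact: svalP.
apply: finite_preimage => // x y _ _ /eq_sig_hprop h.
by apply: (bij_inj fb); exact: h.
Qed.

Lemma line_substructures w : recurrent w -> forall S,
  finite_labeled_unary_forest S <->
  exists2 A : set (line w), finite_set A & isomorphic S (substructure A).
Proof.
move=> wrec S; split=> [SF|[A fA SA]]; last first.
  by split; [exact: isomorphic_finite SA|exact/embeds_forest/isomorphic_embeds/SA].
have [g gI ge] := forest_embeds wrec SF; exists (range (g : S -> line w)).
  by apply: finite_image; case: SF.
exact: embedding_isomorphic.
Qed.

(** * Random subsets of a ball *)

Definition occurs (c : int -> bool * bool) (P : seq (bool * bool)) (p : int) :=
  forall i : nat, (i < size P)%N -> c (p + i%:Z) = nth (false, false) P i.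

(** [P] contains [N.+1] disjoint copies of every window colouring, and at most [N] points cannot be
    near all the copies of a given one. *)
Lemma rich_pattern N r : exists P, forall c p, occurs c P p -> rich c N r.
Proof.
pose d0 := (false, false); pose L := (r + r).+1.
(* Periodic with period [u], hence with [N.+1] disjoint copies of [u]. *)
pose block (u : L.-tuple (bool * bool)) : seq (bool * bool) :=
  mkseq (fun k => nth d0 u (k %% L)) (N.+1 * L).
exists (flatten [seq block u | u <- enum {: L.-tuple (bool * bool)%type}]).
move=> c p cp u n v nN.
pose t := [tuple of mkseq (fun i => u (i%:Z - r%:Z)) L].
have : block t \in [seq block u | u <- enum {: L.-tuple (bool * bool)%type}].
  by apply: map_f; rewrite mem_enum.
move: cp; set bs := map _ _ => cp tb.
have {tb} [bs1 [bs2 Ebs]] : exists bs1 bs2 : seq (seq (bool * bool)),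
    bs = bs1 ++ block t :: bs2.
  by case/splitPr: tb => bs1 bs2; exists bs1, bs2.
have {}cp : occurs c (flatten bs1 ++ (block t ++ flatten bs2)) p.
  by move: cp; rewrite Ebs flatten_cat.
(* The centre of the [j]-th copy of [u]. *)
pose q (j : 'I_N.+1) : int := p + (size (flatten bs1) + (j * L + r))%N%:Z.
have [j qj] : exists j, forall i, (r < `|q j - v i|)%N.
  apply: contrapT => /forallNP near.
  (* The copies of [u] are more than [2 * r] apart, so each [v i] is near at
     most one of them. *)
  have {}near j : {i | (`|q j - v i| <= r)%N}.
    apply: cid; have /existsNP[i /negP] := near j.
    by rewrite -leqNgt; exists i.
  have /leq_card : injective (fun j => sval (near j)).
    move=> i j ij; apply/val_inj; have := svalP (near i).
    rewrite ij; have := svalP (near j); rewrite /q.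
    set y := v _; have [lt|lt|//] := ltngtP i j.
      have : (i.+1 * L <= j * L)%N by rewrite leq_mul2r lt orbT.
      by rewrite mulSn; move: (i * L)%N (j * L)%N => a b; rewrite /L; lia.
    have : (j.+1 * L <= i * L)%N by rewrite leq_mul2r lt orbT.
    by rewrite mulSn; move: (i * L)%N (j * L)%N => a b; rewrite /L; lia.
  by rewrite !card_ord => /leq_trans/(_ nN); rewrite ltnn.
exists (q j); split=> // d dr.
pose k := absz (r%:Z + d)%R.
have kL : (k < L)%N by rewrite /k /L; lia.
have jL : (j * L + k < N.+1 * L)%N.
  apply: (@leq_trans (j.+1 * L)); first by rewrite mulSn addnC ltn_add2r.
  by rewrite leq_mul2r ltn_ord orbT.
have -> : q j + d = p + (size (flatten bs1) + (j * L + k))%N%:Z.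
  by rewrite /q /k; move: (j * L)%N => a; lia.
have bL : size (block t) = (N.+1 * L)%N by rewrite size_mkseq.
rewrite cp; last by rewrite !size_cat bL ltn_add2l (leq_trans jL) ?leq_addr.
rewrite nth_cat ifF ?addKn; last by rewrite ltnNge leq_addr.
rewrite nth_cat bL jL.
rewrite nth_mkseq // modnMDl modn_small // nth_mkseq //.
by congr u; rewrite /k; lia.
Qed.

(* A pair [(W, M)] is a window together with the trace [M] to be avoided on it.
   The traces on disjoint windows are independent. *)
Lemma count_avoid (K : choiceType) (ws : seq ({fset K} * {fset K}))
    (D : {fset K}) (L : nat) :
  (forall wm, wm \in ws ->
    [/\ (wm.1 `<=` D)%fset, (wm.2 `<=` wm.1)%fset & #|` wm.1| = L]) ->
  pairwise (fun wm wm' => wm.1 `&` wm'.1 == fset0)%fset ws ->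
  (count (fun F => all (fun wm => F `&` wm.1 != wm.2)%fset ws) (fpowerset D)
     * (2 ^ L) ^ size ws <= (2 ^ L - 1) ^ size ws * 2 ^ #|` D|)%N.
Proof.
elim: ws D => [|[W M] ws IH] D.
  by move=> _ _; rewrite !expn0 muln1 mul1n -card_fpowerset count_size.
move=> wsD /=/andP[/allP disj pw].
have /= [WD MW WL] := wsD (W, M) (mem_head _ _).
pose av (F : {fset K}) := all (fun wm => F `&` wm.1 != wm.2)%fset ws.
(* The map sending [F] to its parts inside and outside [W] is injective. The inner part is one of
   the [2 ^ L - 1] subsets of [W] other than [M]; the outer part still avoids the remaining traces,
   whose windows are disjoint from [W]. *)
have step : (count (fun F => (F `&` W != M)%fset && av F) (fpowerset D)
    <= (2 ^ L - 1) * count av (fpowerset (D `\` W)%fset))%N.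
  pose A := rem M (fpowerset W).
  have -> : (2 ^ L - 1)%N = size A.
    by rewrite size_rem ?fpowersetE // -WL -card_fpowerset subn1.
  rewrite -!size_filter -(size_allpairs pair).
  rewrite -(size_map (fun F => (F `&` W, F `\` W)%fset)).
  apply: uniq_leq_size.
    rewrite map_inj_uniq ?filter_uniq ?fset_uniq // => F G [FG1 FG2].
    by rewrite -(fsetID W F) -(fsetID W G) FG1 FG2.
  move=> _ /mapP[F + ->]; rewrite mem_filter fpowersetE => /andP[/andP[FM avF] FD].
  apply/allpairsP; exists (F `&` W, F `\` W)%fset; split => //=.
    rewrite mem_rem_uniq ?fset_uniq // inE FM.
    by rewrite fpowersetE fsubsetIr.
  rewrite mem_filter fpowersetE fsetSD // andbT.
  apply/allP => wm wmws; have := allP avF _ wmws; apply: contraNN => /eqP <-.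
  apply/eqP/fsetP => x; rewrite !inE; apply/idP/idP; last by move=> /andP[/andP[_ ->]].
  move=> /andP[-> xwm]; rewrite xwm !andbT.
  apply/negP => xW; have /eqP/fsetP/(_ x) := disj _ wmws.
  by rewrite !inE xW xwm.
have {}IH := IH (D `\` W)%fset _ pw.
have -> : #|` D| = (L + #|` (D `\` W)%fset|)%N.
  by rewrite cardfsDS // WL subnKC // -WL fsubset_leq_card.
rewrite !expnS expnD; apply: leq_trans (leq_mul step (leqnn _)) _.
rewrite mulnACA [leqRHS]mulnACA leq_mul2l IH ?orbT // => wm wmws.
have [wmD wmM wmL] := wsD wm (mem_behead (s := _ :: _) wmws); split => //.
apply/fsubsetP => x xwm; rewrite inE (fsubsetP wmD) // andbT.
apply/negP => xW; have /eqP/fsetP/(_ x) := disj _ wmws.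
by rewrite !inE xW xwm.
Qed.

(** Counting over [{fset int}] turns the subsets into a finite sequence; [ball_fractionE] links this
    fraction to [ball_fraction]. *)
Definition subset_fraction (R : realType) (D : {fset int}) (Q : set int -> Prop) : R :=
  (count (fun F : {fset int} => `[< Q [set` F] >]) (fpowerset D))%:R / (2 ^ #|` D|)%:R.

Lemma subset_fractionC (R : realType) D (Q : set int -> Prop) :
  subset_fraction R D Q = 1 - subset_fraction R D (fun A => ~ Q A).
Proof.
rewrite /subset_fraction -card_fpowerset; apply/eqP.
rewrite eq_sym subr_eq -mulrDl -natrD.
have -> : (count (fun F : {fset int} => `[< ~ Q [set` F] >]) (fpowerset D))
    = count (predC (fun F : {fset int} => `[< Q [set` F] >])) (fpowerset D).
  by apply: eq_count => F /=; rewrite asbool_neg.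
by rewrite count_predC divff // pnatr_eq0 card_fpowerset expn_eq0.
Qed.

Lemma subset_fraction_le (R : realType) D (P Q : set int -> Prop) :
  (forall A, P A -> Q A) -> subset_fraction R D P <= subset_fraction R D Q.
Proof.
move=> PQ; rewrite /subset_fraction ler_wpM2r ?invr_ge0 ?ler0n // ler_nat.
by apply: sub_count => F /asboolP PF; apply/asboolP/PQ.
Qed.

Lemma subset_fraction_ge0 (R : realType) D (P : set int -> Prop) :
  0 <= subset_fraction R D P.
Proof. by rewrite /subset_fraction divr_ge0 ?ler0n. Qed.

Lemma card_subsets (D : {fset int}) (Q : set int -> Prop) :
  #|` fset_set [set A | A `<=` [set` D] /\ Q A]| =
  count (fun F : {fset int} => `[< Q [set` F] >]) (fpowerset D).
Proof.
pose S := [fset F in fpowerset D | `[< Q [set` F] >]]%fset.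
have -> : [set A | A `<=` [set` D] /\ Q A] =
    (fun F : {fset int} => [set` F]) @` [set` S].
  apply/seteqP; split=> [A [AD QA]|B [F]] /=.
    have fA : finite_set A := sub_finite_set AD (finite_fset D).
    exists (fset_set A); last by rewrite fset_setK.
    rewrite !inE /= fset_setK // asboolT // andbT fpowersetE.
    by apply/fsubsetP => x; rewrite in_fset_set // inE => /AD.
  rewrite !inE /= fpowersetE => /andP[/fsubsetP FD /asboolP QF] <-.
  by split=> // x /FD.
rewrite fset_set_image // set_fsetK card_imfset /=; last first.
  by move=> F G /(congr1 (@fset_set int)); rewrite !set_fsetK.
rewrite -size_filter; apply/perm_size/uniq_perm; rewrite ?filter_uniq ?fset_uniq //.
by move=> F; rewrite mem_filter !inE andbC.
Qed.

Definition segment (x : int) (n : nat) : {fset int} :=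
  fset_set [set y : int | (`|y - x| <= n)%N].

Lemma segmentE x n : [set` segment x n] = [set y : int | (`|y - x| <= n)%N].
Proof.
rewrite fset_setK //; pose f (k : nat) := x - n%:Z + k%:Z.
apply: (sub_finite_set (B := f @` `I_(n + n).+1)).
  by move=> y /= yx; exists (absz (y - (x - n%:Z))%R); rewrite /= /f; lia.
exact/finite_image/finite_II.
Qed.

Lemma ball_fractionE (R : realType) l phi (x : line l) n :
  ball_fraction R phi x n = subset_fraction R (segment x n)
    (fun A => models (line_sub l A) phi).
Proof.
rewrite /ball_fraction /subset_fraction gball_line -segmentE.
congr (_%:R / _%:R); first exact: card_subsets.
have -> : [set A | A `<=` [set` segment x n]] =
    [set A | A `<=` [set` segment x n] /\ True].
  by apply/seteqP; split=> A //= -[].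
rewrite (card_subsets _ (fun=> True)) -card_fpowerset -count_predT.
by apply: eq_count => F; rewrite asboolT.
Qed.

(** The labels of [P] recur in [w] beyond any ball, so a further window can always be added outside
    the earlier ones. On a window only membership is free, and [wm.2] is the trace that [P]
    prescribes there. *)
Lemma recurrent_windows w (P : seq (bool * bool)) (x : int) t : recurrent w ->
  exists n0, exists ws : seq ({fset int} * {fset int}),
  [/\ size ws = t,
      forall wm, wm \in ws -> [/\ forall y, y \in wm.1 -> (`|y - x| <= n0)%N,
         (wm.2 `<=` wm.1)%fset & #|` wm.1| = size P],
      pairwise (fun wm wm' => wm.1 `&` wm'.1 == fset0)%fset ws &
      forall (A : {fset int}) wm, wm \in ws -> (A `&` wm.1)%fset = wm.2 ->
        exists p, occurs (colouring w [set` A]) P p].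
Proof.
move=> wrec; elim: t => [|t [n0 [ws [wst wsn wsd wsA]]]]; first by exists 0%N, [::].
have [p pn pw] := wrec (fun i => (nth (false, false) P i).2) (size P) (x + n0%:Z + 1).
pose W := [fset (p + (i : 'I_(size P))%:Z)%R | i in 'I_(size P)]%fset.
pose M := [fset y in W | (nth (false, false) P (absz (y - p)%R)).1]%fset.
have WP y : y \in W -> exists2 i : nat, (i < size P)%N & y = p + i%:Z.
  by move=> /imfsetP[i _ ->]; exists i.
exists (absz (p - x)%R + size P)%N, ((W, M) :: ws); split.
- by rewrite /= wst.
- move=> wm; rewrite inE => /predU1P[->|wmws]; last first.
    by have [h1 h2 h3] := wsn _ wmws; split=> // y /h1; lia.
  split=> /=; first by move=> y /WP[i iP ->]; lia.
    by apply/fsubsetP => y; rewrite !inE => /andP[].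
  rewrite card_imfset /=; last by move=> i j /addrI[] /val_inj.
  by rewrite size_enum_ord.
- rewrite /= wsd andbT; apply/allP => wm wmws; apply/eqP/fsetP => y; rewrite !inE.
  apply/negP => /andP[/WP[i iP ->] ywm].
  by have [/(_ _ ywm)] := wsn _ wmws; lia.
move=> A wm; rewrite inE => /predU1P[->|]; last exact: wsA.
move=> /= AWM; exists p => i iP; rewrite /colouring pw //.
rewrite [RHS]surjective_pairing; congr pair.
have /fsetP/(_ (p + i%:Z)) := AWM; rewrite !inE.
have -> : p + i%:Z \in W by apply/imfsetP; exists (Ordinal iP).
have -> : absz (p + i%:Z - p)%R = i by lia.
by rewrite /= andbT => <-; apply/asboolP/idP.
Qed.

Lemma almost_surely_rich (R : realType) w N r (x : int) : recurrent w ->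
  subset_fraction R (segment x n) (fun A => ~ rich (colouring w A) N r)
    @[n --> \oo] --> (0 : R).
Proof.
move=> wrec; have [P Prich] := rich_pattern N r.
pose L := size P; pose a : R := (2 ^ L - 1)%:R / (2 ^ L)%:R.
have pos2 k : (0 : R) < (2 ^ k)%:R by rewrite ltr0n expn_gt0.
have a0 : 0 <= a by rewrite divr_ge0 ?ler0n.
have a1 : a < 1 by rewrite ltr_pdivrMr // mul1r ltr_nat subn1 ltn_predL expn_gt0.
(* A set that is not rich avoids the prescribed trace on each of [t] disjoint windows, and each
   window contributes a factor [a]. *)
have bound t : exists n0, forall n, (n0 <= n)%N ->
    subset_fraction R (segment x n) (fun A => ~ rich (colouring w A) N r) <= a ^+ t.
  have [n0 [ws [wst wsn wsd wsA]]] := recurrent_windows P x t wrec.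
  exists n0 => n n0n.
  have := @count_avoid _ ws (segment x n) L _ wsd; rewrite wst => H.
  have {}H := H _.
  rewrite ler_pdivrMr // expr_div_n mulrAC ler_pdivlMr ?exprn_gt0 //.
  rewrite -!natrX -!natrM ler_nat.
  apply: leq_trans (H _) => [|wm wmws].
    rewrite leq_mul2r; apply/orP; right; apply: sub_count => F /asboolP nr.
    apply/allP => wm wmws; apply/negP => /eqP Fwm; apply: nr.
    by have [p] := wsA _ _ wmws Fwm; exact: Prich.
  have [h1 h2 h3] := wsn _ wmws; split=> //.
  apply/fsubsetP => y /h1 yx; have : [set` segment x n] y; last by [].
  by rewrite segmentE /=; apply: leq_trans yx n0n.
apply/cvgrPdist_le => e e0.
have : (fun t => a ^+ t) @ \oo --> (0 : R).
  by apply: cvg_expr; rewrite ger0_norm.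
move=> /cvgrPdist_le/(_ e e0)[t _ /(_ t (leqnn t))] /=.
rewrite sub0r normrN ger0_norm ?exprn_ge0 // => ate.
have [n0 bn] := bound t; exists n0 => // n /= n0n.
rewrite sub0r normrN ger0_norm ?subset_fraction_ge0 //.
exact: le_trans (bn n n0n) ate.
Qed.

(** By [rich_models] all good sets give [phi] the same truth value, and almost all sets are good. *)
Lemma line_zero_one (R : realType) w phi : recurrent w ->
  almost_surely_true R (line w) phi \/ almost_surely_false R (line w) phi.
Proof.
move=> wrec; set k := qrank phi.
pose good (A : set int) := rich (colouring w A) k (2 ^ k).
pose sats (A : set int) := models (line_sub w A) phi.
have cvg0 (x : int) Q : (forall A, Q A -> ~ good A) ->
    subset_fraction R (segment x n) Q @[n --> \oo] --> (0 : R).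
  move=> Qgood; 
  have := @almost_surely_rich R w k (2 ^ k) x wrec.
  apply: (@squeeze_cvgr _ _ _ _ (fun=> 0)); last exact: cvg_cst.
  by near=> n; rewrite subset_fraction_ge0 subset_fraction_le.
have [[A gA sA]|ngood] := pselect (exists2 A, good A & sats A).
  left=> x; rewrite (_ : ball_fraction _ _ _ =
    (fun n => 1 - subset_fraction R (segment x n) (fun A => ~ sats A))); last first.
    by apply/funext => n; rewrite ball_fractionE subset_fractionC.
  rewrite -[X in _ --> X]subr0; apply: cvgB; first exact: cvg_cst.
  by apply: cvg0 => B nB gB; apply: nB; apply/(rich_models gA gB).
right=> x; rewrite (_ : ball_fraction _ _ _ =
    (fun n => subset_fraction R (segment x n) sats)); last first.
  by apply/funext => n; rewrite ball_fractionE.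
by apply: cvg0 => A sA gA; apply: ngood; exists A.
Unshelve. all: by end_near. Qed.

Lemma geometric_law (R : realType) :
  geometric_zero_one_law R finite_labeled_unary_forest.
Proof.
have [w wrec] := recurrent_word; exists (line w); split.
- by split; [exact: line_infinite|exact: line_connected].
- exact: line_bounded_degree.
- exact: line_duplicate.
- exact: line_substructures.
- by move=> phi; exact: line_zero_one.
Qed.

(** * Counting forests with isolated vertices *)

Lemma expr_unbounded (R : realType) (x M : R) : 1 < x -> exists k, M < x ^+ k.
Proof.
move=> x1; have x0 : 0 < x by exact: lt_trans x1.
have : (fun k => x^-1 ^+ k) @ \oo --> (0 : R).
  by apply: cvg_expr; rewrite ger0_norm ?invr_ge0 ?ltW // invf_lt1.
have e0 : 0 < (`|M| + 1)^-1 by rewrite invr_gt0 ltr_wpDl.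
move=> /cvgrPdist_lt/(_ _ e0)[k _ /(_ k (leqnn k))] /=.
rewrite sub0r normrN ger0_norm ?exprn_ge0 ?invr_ge0 ?ltW // exprVn.
rewrite ltf_pV2 ?posrE ?exprn_gt0 ?ltr_wpDl // => h; exists k.
by apply: le_lt_trans (lt_trans _ h); [exact: ler_norm|rewrite ltrDl].
Qed.

Lemma ratio_not_zero_or_one (R : realType) (a h : nat -> R) :
  (forall n, 0 < a n) -> (forall n, 2 ^+ n <= a n.+1) ->
  (forall n, a n <= 4 ^+ n) ->
  (forall n, a n - h n <= h n.+1 <= a n) ->
  ~ zero_or_one (fun n => h n / a n).
Proof.
move=> a0 a_ge a_le ha [/cvgrPdist_lt/(_ 6^-1)|/cvgrPdist_lt/(_ 3^-1)].
- rewrite invr_gt0 ltr0n => /(_ isT)[m _ hm].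
  have {}hm n : (m <= n)%N -> h n <= a n / 6.
    move=> /hm /=; rewrite sub0r normrN ltr_norml => /andP[_].
    by rewrite ltr_pdivrMr // => /ltW; rewrite mulrC.
  (* The inequalities [a n - a n / 6 <= h n.+1 <= a n.+1 / 6] give the factor 5, which outgrows the
     bound [4 ^+ n]. *)
  have grow k : a m * 5 ^+ k <= a (m + k)%N.
    elim: k => [|k IH]; first by rewrite addn0 mulr1.
    have := hm (m + k).+1 ltac:(lia); have := hm (m + k)%N ltac:(lia).
    have /andP[] := ha (m + k)%N; rewrite addnS exprS.
    move: IH (a _.+1) (h _.+1) (h _); move: (a (m + k)%N) (5 ^+ k); move: (a m).
    by move=> A B C IH D E F; lra.
  have [k] := @expr_unbounded R (5 / 4) (4 ^+ m / a m) ltac:(lra).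
  rewrite ltr_pdivrMr // expr_div_n mulrAC ltr_pdivlMr ?exprn_gt0 // -exprD.
  by rewrite ltNge mulrC (le_trans (grow k)).
- rewrite invr_gt0 ltr0n => /(_ isT)[m _ hm].
  have {}hm n : (m <= n)%N -> 2 / 3 * a n <= h n.
    move=> /hm /=; rewrite ltr_norml => /andP[_ lt3].
    by rewrite -ler_pdivlMr //; move: lt3; move: (h n / a n) => y; lra.
  (* The inequalities [2 / 3 * a n.+1 <= h n.+1 <= a n] give a factor of at most 3/2. *)
  have grow k : a (m + k)%N <= a m * (3 / 2) ^+ k.
    elim: k => [|k IH]; first by rewrite addn0 mulr1.
    have := hm (m + k).+1 ltac:(lia).
    have /andP[_] := ha (m + k)%N; rewrite addnS exprS.
    move: IH (a _.+1) (h _.+1); move: (a (m + k)%N) ((3 / 2) ^+ k); move: (a m).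
    by move=> A B C IH D E; lra.
  (* Since [2 ^+ k <= a (m + k).+1 <= a m * (3 / 2) ^+ k.+1], all powers of 4/3 would be bounded by
     [a m * 3 / 2]. *)
  have [k] := @expr_unbounded R (4 / 3) (a m * 3 / 2) ltac:(lra).
  apply/negP; rewrite -leNgt.
  have p0 : 0 < (3 / 2) ^+ k :> R by apply: exprn_gt0; lra.
  rewrite -(ler_pM2r p0) -exprMn (_ : 4 / 3 * (3 / 2) = 2); last by field.
  have := a_ge (m + k)%N; have := grow k.+1; rewrite addnS.
  have : 2 ^+ k <= 2 ^+ (m + k) :> R by rewrite ler_eXn2l ?ltr1n // leq_addl.
  rewrite exprS; move: ((3 / 2) ^+ k) (2 ^+ k) (2 ^+ (m + k)) (a _.+1) (a m).
  by move=> A B C D E; lra.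
Qed.

Local Close Scope classical_set_scope.

(** As [c x] depends only on [c' (f x)], the values of [c] on [A] are covered by an image of the
    values of [c'] on [B]. With [c] the class map, this bounds a number of classes through a map on
    representatives. *)
Lemma leq_card_imset_factor (T T' K K' : finType) (c : T -> K) (c' : T' -> K')
    (A : {set T}) (B : {set T'}) (f : T -> T') :
  (forall x, x \in A -> f x \in B) ->
  (forall x y, x \in A -> y \in A -> c' (f x) = c' (f y) -> c x = c y) ->
  (#|c @: A| <= #|c' @: B|)%N.
Proof.
move=> fAB cf; have [->|[a aA]] := set_0Vmem A; first by rewrite imset0 cards0.
pose g (k : K') := c (odflt a [pick x in A | c' (f x) == k]).
apply: leq_trans (leq_imset_card g (c' @: B)).
apply/subset_leq_card/fintype.subsetP.
move=> _ /imsetP[x xA ->]; apply/imsetP; exists (c' (f x)).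
  by apply/imset_f/fAB.
rewrite /g; case: pickP => [y /andP[yA /eqP yx]|/(_ x)] /=; first exact: cf.
by rewrite xA eqxx.
Qed.

Lemma class_onE n (r : str_on n) :
  r \in class_on finite_labeled_unary_forest n <->
  exists l, embeds l (structure_of r).
Proof.
rewrite inE; split=> [/asboolP rC|[l rl]].
  by have [w wrec] := recurrent_word; exists w; exact: forest_embeds.
by apply/asboolP; split; [exact: finite_finset|exact: embeds_forest rl].
Qed.

Local Notation forests n := (class_on finite_labeled_unary_forest n).

Definition isolated n (r : str_on n) (v : 'I_n) : bool :=
  [forall i, forall y, ~~ r (i, v, y) && ~~ r (i, y, v)].

Lemma isolatedP n (r : str_on n) v :
  reflect (forall i y, r (i, v, y) = false /\ r (i, y, v) = false) (isolated r v).
Proof.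
apply: (iffP forallP) => [h i y|h i].
  by have /forallP/(_ y)/andP[/negPf -> /negPf ->] := h i.
by apply/forallP => y; have [-> ->] := h i y.
Qed.

Definition has_isolated n (r : str_on n) : bool := [exists v, isolated r v].

(** An existential written as a negated universal. In the de Bruijn numbering [x] is the candidate
    for an isolated vertex, and each use of [never] binds its own [y]. *)
Definition isolated_sentence : sentence :=
  let x : 'I_2 := lift ord0 ord0 in let y : 'I_2 := ord0 in
  let never i u v := FAll (FImp (@FEdge 2 i u v) (FBot 2)) in
  FImp (FAll (FImp (never false x y) (FImp (never true x y)
    (FImp (never false y x) (FImp (never true y x) (FBot 1)))))) (FBot 0).

Lemma models_isolated_sentence n (r : str_on n) :
  models (structure_of r) isolated_sentence <-> has_isolated r.
Proof.
rewrite /models /=; split=> [h|/existsP[v /isolatedP rv]].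
  apply: contrapT => nex; apply: h => v h1 h2 h3 h4; apply: nex.
  apply/existsP; exists v; apply/isolatedP => i y.
  have := h1 y; have := h2 y; have := h3 y; have := h4 y.
  rewrite !env_consS !env_cons0.
  by case: i => /negP/negPf e1 /negP/negPf e2 /negP/negPf e3 /negP/negPf e4.
by move=> h; apply: (h v) => a; rewrite !env_consS !env_cons0 /=;
  [rewrite (rv _ _).1|rewrite (rv _ _).1|rewrite (rv _ _).2|rewrite (rv _ _).2].
Qed.

(** * Insertion and deletion of an isolated vertex, and isomorphism *)

Definition insert n (v : 'I_n.+1) (r : str_on n) : str_on n.+1 :=
  [ffun t => if (unlift v t.1.2, unlift v t.2) is (Some x, Some y)
             then r (t.1.1, x, y) else false].

Definition delete n (v : 'I_n.+1) (s : str_on n.+1) : str_on n :=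
  [ffun t => s (t.1.1, lift v t.1.2, lift v t.2)].

Lemma insert_lift n (v : 'I_n.+1) (r : str_on n) i x y :
  insert v r (i, lift v x, lift v y) = r (i, x, y).
Proof. by rewrite ffunE /= !liftK. Qed.

Lemma isolated_insert n (v : 'I_n.+1) (r : str_on n) : isolated (insert v r) v.
Proof.
apply/isolatedP => i y; rewrite !ffunE /= unlift_none.
by case: unlift.
Qed.

Lemma insertK n (v : 'I_n.+1) : cancel (insert v) (delete v).
Proof. by move=> r; apply/ffunP => -[[i x] y]; rewrite ffunE /= insert_lift. Qed.

Lemma deleteK n (v : 'I_n.+1) (s : str_on n.+1) :
  isolated s v -> insert v (delete v s) = s.
Proof.
move=> /isolatedP sv; apply/ffunP => -[[i x] y]; rewrite ffunE /=.
case: unliftP => [x' ->|->]; last by have [->] := sv i y.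
case: unliftP => [y' ->|->]; last by have [_ ->] := sv i (lift v x').
by rewrite ffunE.
Qed.

Lemma isolated_insert_lift n (v : 'I_n.+1) (r : str_on n) x :
  isolated (insert v r) (lift v x) = isolated r x.
Proof.
apply/isolatedP/isolatedP => h i y.
  by rewrite -!(insert_lift v).
case: (unliftP v y) => [z ->|->]; first by rewrite !insert_lift.
by have /isolatedP/(_ i (lift v x))[-> ->] := isolated_insert v r.
Qed.

Lemma insert_forest n (v : 'I_n.+1) (r : str_on n) :
  (insert v r \in forests n.+1) = (r \in forests n).
Proof.
apply/idP/idP => /class_onE[l [g gI ge]]; apply/class_onE; exists l.
  exists (fun x => g (lift v x)) => [x y /gI/lift_inj//|i x y].
  by rewrite -ge /= insert_lift.
have [K Kg] := finite_bounded g (@finite_finset _ _).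
(* The position [K + 2] is at distance at least 2 from every value of [g], so the new vertex gets no
   edge. *)
exists (fun x => if unlift v x is Some x' then g x' else K%:Z + 2) => [x y|i x y].
  case: (unliftP v x) => [x' ->|->]; case: (unliftP v y) => [y' ->|->] //.
  - by move=> /gI ->.
  - by have := Kg x'; lia.
  - by have := Kg y'; lia.
rewrite /= ffunE /=; case: unliftP => [x' _|_]; case: unliftP => [y' _|_].
- exact: ge.
- by split=> // -[]; have := Kg x'; lia.
- by split=> // -[]; have := Kg y'; lia.
- by split=> // -[]; lia.
Qed.

Definition act n (s : 'S_n) (r : str_on n) : str_on n :=
  [ffun t => r (t.1.1, s t.1.2, s t.2)].

Definition iso n (r s : str_on n) : bool :=
  `[< isomorphic (structure_of r) (structure_of s) >].

Lemma isoP n (r s : str_on n) : reflect (exists p, r = act p s) (iso r s).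
Proof.
apply: (iffP (asboolP _)) => [[f fb fe]|[p ->]].
  exists (perm (bij_inj fb)); apply/ffunP => -[[i x] y]; rewrite ffunE /= !permE.
  by apply/idP/idP => h; apply/fe.
exists p => [|i x y]; last by rewrite /= ffunE.
by exists (p^-1)%g => x; rewrite ?permK ?permKV.
Qed.

Lemma iso_refl n (r : str_on n) : iso r r.
Proof.
by apply/isoP; exists 1%g; apply/ffunP => -[[i x] y]; rewrite ffunE /= !perm1.
Qed.

Lemma iso_sym n (r s : str_on n) : iso r s -> iso s r.
Proof.
move=> /isoP[p ->]; apply/isoP; exists (p^-1)%g.
by apply/ffunP => -[[i x] y]; rewrite !ffunE /= !permKV.
Qed.

Lemma iso_trans n (s r t : str_on n) : iso r s -> iso s t -> iso r t.
Proof.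
move=> /isoP[p ->] /isoP[q ->]; apply/isoP; exists (p * q)%g.
by apply/ffunP => -[[i x] y]; rewrite !ffunE /= !permM.
Qed.

Lemma has_isolated_iso n (r s : str_on n) :
  iso r s -> has_isolated r = has_isolated s.
Proof.
have imp (u t : str_on n) : iso u t -> has_isolated u -> has_isolated t.
  move=> /isoP[p ->] /existsP[v /isolatedP uv]; apply/existsP; exists (p v).
  apply/isolatedP => i y; have := uv i ((p^-1)%g y).
  by rewrite !ffunE /= permKV.
by move=> rs; apply/idP/idP; apply: imp => //; exact: iso_sym.
Qed.

(** An isomorphism extends by sending [v] to [v'], so the place of insertion does not affect the
    class. *)
Lemma iso_insert n (v v' : 'I_n.+1) (r r' : str_on n) :
  iso r r' -> iso (insert v r) (insert v' r').
Proof.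
move=> /isoP[p ->].
pose f x := if unlift v x is Some x' then lift v' (p x') else v'.
have fl x : f (lift v x) = lift v' (p x) by rewrite /f liftK.
have fv : f v = v' by rewrite /f unlift_none.
have fI : injective f.
  move=> x y; case: (unliftP v x) => [x' ->|->]; case: (unliftP v y) => [y' ->|->];
    rewrite ?fl ?fv //.
  - by move=> /lift_inj/perm_inj ->.
  - by move/eqP; rewrite eq_sym (negPf (neq_lift _ _)).
  - by move/eqP; rewrite (negPf (neq_lift _ _)).
apply/isoP; exists (perm fI); apply/ffunP => -[[i x] y].
rewrite [RHS]ffunE /= !permE.
have /isolatedP iv := isolated_insert v (act p r').
have /isolatedP iv' := isolated_insert v' r'.
case: (unliftP v x) => [x' ->|->]; last by rewrite fv (iv i y).1 (iv' i _).1.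
case: (unliftP v y) => [y' ->|->]; last by rewrite fv (iv i _).2 (iv' i _).2.
by rewrite !fl !insert_lift ffunE.
Qed.

(** As [r'] has no isolated vertex, [v'] is the only one of [insert v' r']; an isomorphism must send
    [v] to it and so restricts to the other vertices. *)
Lemma insert_iso n (v v' : 'I_n.+1) (r r' : str_on n) : ~~ has_isolated r' ->
  iso (insert v r) (insert v' r') -> iso r r'.
Proof.
move=> nr' /isoP[p pr].
have pv : p v = v'.
  have /isolatedP iv := isolated_insert v r.
  have : isolated (insert v' r') (p v).
    apply/isolatedP => i y; have := iv i ((p^-1)%g y).
    by rewrite pr !ffunE /= permKV.
  case: (unliftP v' (p v)) => [x ->|//]; rewrite isolated_insert_lift => rx.
  by case/negP: nr'; apply/existsP; exists x.
pose f x := odflt x (unlift v' (p (lift v x))).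
have fl x : lift v' (f x) = p (lift v x).
  rewrite /f; case: unliftP => //= /eqP.
  by rewrite -pv (inj_eq perm_inj) eq_sym (negPf (neq_lift _ _)).
have fI : injective f.
  by move=> x y /(congr1 (lift v')); rewrite !fl => /perm_inj/lift_inj.
apply/isoP; exists (perm fI); apply/ffunP => -[[i x] y].
by rewrite ffunE /= !permE -(insert_lift v' r') !fl -(insert_lift v r) pr ffunE.
Qed.

(** * Counting labeled forests *)

Definition with_isolated n : {set str_on n} :=
  [set r in forests n | has_isolated r]%SET.

Definition without_isolated n : {set str_on n} :=
  [set r in forests n | ~~ has_isolated r]%SET.

Lemma card_forests_split n :
  #|forests n| = (#|with_isolated n| + #|without_isolated n|)%N.
Proof.
rewrite -(cardsID [set r | has_isolated r]%SET (forests n)).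
by congr (_ + _)%N; apply: eq_card => r; rewrite !inE // andbC.
Qed.

(** Every forest with an isolated vertex arises by inserting one, at one of [n.+1] places, into a
    forest on [n] vertices. *)
Lemma card_with_isolated_le n : (#|with_isolated n.+1| <= n.+1 * #|forests n|)%N.
Proof.
pose f (t : 'I_n.+1 * str_on n) := insert t.1 t.2.
have -> : (n.+1 * #|forests n|)%N = #|finset.setX [set: 'I_n.+1]%SET (forests n)|.
  by rewrite cardsX cardsT card_ord.
apply: leq_trans (leq_imset_card f _); apply/subset_leq_card/fintype.subsetP => s.
rewrite inE => /andP[sC /existsP[v sv]]; apply/imsetP; exists (v, delete v s).
  by rewrite inE finset.in_setT /= -(insert_forest v) deleteK.
by rewrite /f /= deleteK.
Qed.

(** Insertion is injective here: the inserted vertex is the only isolated one, so its place and the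
    remaining forest can be recovered. *)
Lemma card_without_isolated_le n :
  (n.+1 * #|without_isolated n| <= #|with_isolated n.+1|)%N.
Proof.
pose f (t : 'I_n.+1 * str_on n) := insert t.1 t.2.
pose A := finset.setX [set: 'I_n.+1]%SET (without_isolated n).
have -> : (n.+1 * #|without_isolated n|)%N = #|A|.
  by rewrite cardsX cardsT card_ord.
rewrite -(@card_in_imset _ _ f); first apply/subset_leq_card/fintype.subsetP.
  move=> _ /imsetP[[v r] + ->].
  rewrite finset.in_setX finset.in_setT /= inE => /andP[rC _].
  rewrite inE insert_forest rC; apply/existsP; exists v; exact: isolated_insert.
move=> [v r] [v' r']; rewrite !finset.in_setX !finset.in_setT /= => _.
rewrite inE => /andP[_ nr'] rr'.
rewrite /f /= in rr'.
have vv' : v = v'.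
  have := isolated_insert v r; rewrite rr'.
  case: (unliftP v' v) => [x ->|//]; rewrite isolated_insert_lift => rx.
  by case/negP: nr'; apply/existsP; exists x.
by subst v'; rewrite -(insertK v r) rr' insertK.
Qed.

(** A single path through all the vertices: [s x] is the position of [x] on it, and [b] lists the
    labels of its edges. *)
Definition path_structure n (s : 'S_n.+1) (b : n.-tuple bool) : str_on n.+1 :=
  [ffun t => (s t.2 == (s t.1.2).+1 :> nat) && (nth false b (s t.1.2) == t.1.1)].

Lemma path_structure_forest n s b : @path_structure n s b \in forests n.+1.
Proof.
apply/class_onE; exists (fun k => nth false b (absz k)).
exists (fun x : 'I_n.+1 => (s x)%:Z) => [x y [/val_inj/perm_inj]//|i x y].
rewrite /= ffunE /=; split=> [/andP[/eqP -> /eqP <-]|[h <-]].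
  by split=> //; rewrite -addn1 PoszD.
by rewrite eqxx andbT; apply/eqP; lia.
Qed.

(** Successors on the path can be read off the edges, so induction along the path bounds each
    position under [s] by that under [s']. Symmetry gives equality, and the labels are then read
    between consecutive vertices. *)
Lemma path_structure_inj n (s s' : 'S_n.+1) b b' :
  path_structure s b = path_structure s' b' -> (s, b) = (s', b').
Proof.
move=> H.
have val_eq (p : 'S_n.+1) c i x y : path_structure p c (i, x, y) =
    (p y == (p x).+1 :> nat) && (nth false c (p x) == i) by rewrite ffunE.
have succ (p q : 'S_n.+1) c d : path_structure p c = path_structure q d ->
    forall x y, p y = (p x).+1 :> nat -> q y = (q x).+1 :> nat.
  move=> E x y pxy; have := val_eq p c (nth false c (p x)) x y.
  by rewrite pxy !eqxx E val_eq => /andP[/eqP].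
have le (p q : 'S_n.+1) c d : path_structure p c = path_structure q d ->
    forall k x, p x = k :> nat -> (k <= q x)%N.
  move=> E; elim=> [//|k IH] x px.
  have kn : (k < n.+1)%N by have := ltn_ord (p x); lia.
  pose z := (p^-1)%g (Ordinal kn).
  have pz : p z = k :> nat by rewrite permKV.
  by rewrite (succ p q c d E z x) ?ltnS ?IH // px pz.
have ss' : s = s'.
  apply/permP => x; apply/val_inj/eqP; rewrite eqn_leq /=.
  by rewrite (le s s' b b' H _ x erefl) (le s' s b' b (esym H) _ x erefl).
subst s'; congr pair; apply/val_inj/(@eq_from_nth _ false).
  by rewrite !size_tuple.
rewrite size_tuple => k kn.
have k1 : (k < n.+1)%N by exact: ltnW.
have k2 : (k.+1 < n.+1)%N by [].
have := val_eq s b (nth false b k) ((s^-1)%g (Ordinal k1)) ((s^-1)%g (Ordinal k2)).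
by rewrite H val_eq !permKV !eqxx /= => /eqP.
Qed.

Lemma card_forests_ge n : (n.+1`! * 2 ^ n <= #|forests n.+1|)%N.
Proof.
pose f (t : 'S_n.+1 * n.-tuple bool) := path_structure t.1 t.2.
have -> : (n.+1`! * 2 ^ n)%N = #|[set: 'S_n.+1 * n.-tuple bool]%SET|.
  by rewrite cardsT card_prod card_Sn card_tuple card_bool.
rewrite -(@card_imset _ _ f); last by move=> [s b] [s' b'] /path_structure_inj.
apply/subset_leq_card/fintype.subsetP => _ /imsetP[[s b] _ ->].
exact: path_structure_forest.
Qed.

Lemma forests_neq0 n : forests n != finset.set0.
Proof.
rewrite -card_gt0; case: n => [|n].
  apply/card_gt0P; exists [ffun=> false]; apply/class_onE.
  by exists (fun=> false); exists (fun=> 0) => [[]//|i []].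
by apply: leq_trans (card_forests_ge n); rewrite muln_gt0 fact_gt0 expn_gt0.
Qed.

(** * Counting isomorphism classes *)

Definition cls n (r : str_on n) : {set str_on n} :=
  [set s in forests n | iso r s]%SET.

Lemma cls_eq n (r s : str_on n) : iso r s -> cls r = cls s.
Proof.
move=> rs; apply/setP => t; rewrite !inE; congr (_ && _).
by apply/idP/idP; apply: iso_trans => //; exact: iso_sym.
Qed.

Lemma eq_cls n (r s : str_on n) : s \in forests n -> cls r = cls s -> iso r s.
Proof.
by move=> sC rs; have : s \in cls s; [rewrite inE sC iso_refl|rewrite -rs inE sC].
Qed.

Lemma card_classes_le n :
  (#|[set cls r | r in forests n]%SET| <= 4 ^ n)%N.
Proof.
pose std (e : {ffun 'I_n -> bool * bool}) : str_on n :=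
  [ffun t : bool * 'I_n * 'I_n =>
    [&& t.2 == t.1.2.+1 :> nat, (e t.1.2).1 & (e t.1.2).2 == t.1.1]].
have code (r : str_on n) : exists e, r \in forests n -> iso r (std e).
  have [/class_onE[l [g gI ge]]|_] := boolP (r \in _); last first.
    by exists [ffun=> (true, true)].
  (* Vertices are numbered in the order of [g]; the first bit of the code tells
     whether a vertex is joined to the next one, the second bit is the label. *)
  pose below x := [set y | g y < g x]%SET.
  have lt x y : g x < g y -> (#|below x| < #|below y|)%N.
    move=> xy; apply/proper_card/properP; split.
      by apply/fintype.subsetP => z; rewrite !inE => /lt_trans; exact.
    by exists x; rewrite !inE ?ltxx.
  have bn x : (#|below x| < n)%N.
    rewrite -[X in (_ < X)%N]card_ord -cardsT; apply/proper_card/properP.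
    by split; [exact: finset.subsetT|exists x; rewrite !inE ?ltxx].
  pose rk x := Ordinal (bn x).
  have rkI : injective rk.
    move=> x y /(congr1 val) /= xy; apply: gI.
    by have [/lt|/lt|//] := ltgtP (g x) (g y); rewrite xy ltnn.
  have rkS x y : g y = g x + 1 -> rk y = (rk x).+1 :> nat.
    move=> xy /=; have -> : below y = (x |: below x)%SET.
      apply/setP => z; rewrite !inE xy; apply/idP/orP => [zx|[/eqP ->|]]; try lia.
      have [->|nzx] := eqVneq z x; [by left|right].
      by have : g z != g x; [rewrite (inj_eq gI)|lia].
    by rewrite cardsU1 inE ltxx.
  exists [ffun j => (`[< exists x z, rk x = j /\ g z = g x + 1 >],
                     `[< exists x, rk x = j /\ l (g x) >])].
  move=> _; apply/isoP; exists (perm rkI); apply/ffunP => -[[i x] y].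
  rewrite !ffunE /= !permE.
  apply/idP/and3P => [/ge[xy lx]|[/eqP xy /asboolP[x' [z [/rkI -> zx]]] /eqP lx]].
    split; first by apply/eqP/rkS.
      by apply/asboolP; exists x, y.
    rewrite -lx; apply/eqP; case: (l (g x)) / (boolP (l (g x))) => lx'.
      by apply/asboolT; exists x.
    by apply/asboolF => -[x' [/rkI ->]]; apply/negP.
  (* The first bit of the code gives [x] a successor [z]; [y] has the same rank as [z] and hence
     equals it. *)
  have -> : y = z by apply/rkI/val_inj; exact: etrans xy (esym (rkS _ _ zx)).
  apply/ge; split => //; rewrite -lx; case: asboolP => [[x'' [/rkI -> //]]|nx].
  by apply/negbTE/negP => lgx; apply: nx; exists x.
pose f r := sval (cid (code r)).
have -> : (4 ^ n)%N = #|id @: [set: {ffun 'I_n -> bool * bool}]%SET|.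
  by rewrite imset_id cardsT card_ffun card_prod card_bool card_ord.
(* Forests with equal codes are isomorphic to the same standard structure, so the class is a
   function of the code. *)
apply: (@leq_card_imset_factor _ _ _ _ _ _ _ _ f) => // r s rC sC rs.
have := svalP (cid (code r)) rC; rewrite -/(f r) [f r]rs => rf.
by apply: cls_eq; apply: iso_trans rf (iso_sym _); exact: svalP (cid (code s)) sC.
Qed.

(* A class has at most [n!] members, since ['S_n] acts transitively on it. *)
Lemma card_forests_le n :
  (#|forests n| <= n`! * #|[set cls r | r in forests n]%SET|)%N.
Proof.
have eqv : {in forests n & &, equivalence_rel (@iso n)}.
  move=> r s t _ _ _; split; first exact: iso_refl.
  by move=> rs; apply/idP/idP; apply: iso_trans => //; exact: iso_sym.
rewrite (card_partition (equivalence_partitionP eqv)) mulnC -sum_nat_const.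
apply: leq_sum => _ /imsetP[r _ ->].
rewrite -card_Sn -cardsT; apply: leq_trans (leq_imset_card (fun p => act p r) _).
apply/subset_leq_card/fintype.subsetP => s; rewrite inE => /andP[_ /iso_sym/isoP[p ->]].
by apply/imsetP; exists p.
Qed.

(** The class of [s] can be recovered from that of [f s], since inserting an isolated vertex yields
    the same class at every place. *)
Lemma card_classes_with_isolated_le n :
  (#|[set cls r | r in with_isolated n.+1]%SET| <= #|[set cls r | r in forests n]%SET|)%N.
Proof.
pose f (s : str_on n.+1) := delete (odflt ord0 [pick v | isolated s v]) s.
have fP s : s \in with_isolated n.+1 ->
    s \in forests n.+1 /\ exists v, s = insert v (f s).
  rewrite inE => /andP[sC /existsP[v sv]]; split=> //.
  rewrite /f; case: pickP => [u su|/(_ v)]; last by rewrite sv.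
  by exists u; rewrite deleteK.
have fC s : s \in with_isolated n.+1 -> f s \in forests n.
  by move=> /fP[+ [v sv]]; rewrite {1}sv insert_forest.
apply: (@leq_card_imset_factor _ _ _ _ _ _ _ _ f) => // r s rC sC.
move=> /(eq_cls (fC _ sC)) rs; apply: cls_eq.
have [_ [v ->]] := fP _ rC; have [_ [u ->]] := fP _ sC.
exact: iso_insert.
Qed.

(** By [insert_iso], insertion keeps distinct classes without isolated vertices distinct. *)
Lemma card_classes_without_isolated_le n :
  (#|[set cls r | r in without_isolated n]%SET| <=
   #|[set cls r | r in with_isolated n.+1]%SET|)%N.
Proof.
have fC r : r \in without_isolated n -> insert ord0 r \in with_isolated n.+1.
  rewrite inE => /andP[rC _]; rewrite inE insert_forest rC.
  by apply/existsP; exists ord0; exact: isolated_insert.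
apply: (@leq_card_imset_factor _ _ _ _ _ _ _ _ (insert ord0)) => // r s rC sC.
move=> /eq_cls rs; apply/cls_eq/(insert_iso (v := ord0) (v' := ord0)).
  by move: sC; rewrite inE => /andP[].
by apply: rs; have := fC _ sC; rewrite inE => /andP[].
Qed.

Lemma card_classes_split n :
  (#|[set cls r | r in forests n]%SET| <=
   #|[set cls r | r in with_isolated n]%SET| +
   #|[set cls r | r in without_isolated n]%SET|)%N.
Proof.
have -> : forests n = (with_isolated n :|: without_isolated n)%SET.
  by apply/setP => r; rewrite !inE -andb_orr orbN andbT.
by rewrite imsetU cardsU leq_subr.
Qed.

Lemma classes_isolated n :
  [set K in iso_classes finite_labeled_unary_forest n |
    [forall r in K, `[< models (structure_of r) isolated_sentence >]]]%SET
  = [set cls r | r in with_isolated n]%SET.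
Proof.
apply/setP => K; rewrite inE; apply/andP/imsetP.
  move=> [/imsetP[r rC ->] /forall_inP H]; exists r => //; rewrite inE rC.
  by apply/models_isolated_sentence/asboolP/H; rewrite inE rC; exact: iso_refl.
move=> [r + ->]; rewrite inE => /andP[rC ri]; split.
  by apply/imsetP; exists r.
apply/forall_inP => s; rewrite inE => /andP[_ rs].
by apply/asboolP/models_isolated_sentence; rewrite -(has_isolated_iso rs).
Qed.

(** * Failure of the labeled and unlabeled laws *)

Lemma not_labeled_law (R : realType) :
  ~ labeled_zero_one_law R finite_labeled_unary_forest.
Proof.
move=> /(_ isolated_sentence).
pose a n : R := #|forests n|%:R / n`!%:R.
pose h n : R := #|with_isolated n|%:R / n`!%:R.
have f0 n : (0 : R) < n`!%:R by rewrite ltr0n fact_gt0.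
rewrite (_ : labeled_fraction R _ _ = fun n => h n / a n); last first.
  apply/funext => n; rewrite /labeled_fraction /h /a invf_div mulrA mulfVK ?gt_eqF //.
  congr (_%:R / _); apply: eq_card => r; rewrite !inE; congr (_ && _).
  by apply/asboolP/idP => /models_isolated_sentence.
apply: ratio_not_zero_or_one => n.
- by rewrite divr_gt0 // ltr0n card_gt0 forests_neq0.
- by rewrite ler_pdivlMr // -natrX -natrM ler_nat mulnC card_forests_ge.
- rewrite ler_pdivrMr // -natrX -natrM ler_nat mulnC.
  by apply: leq_trans (card_forests_le n) _; rewrite leq_mul2l card_classes_le orbT.
(* Here [a n - h n] is the scaled count of forests without isolated vertices, and the factor [n.+1]
   for the place of insertion is absorbed by the quotient of factorials. *)
rewrite /a /h -mulrBl card_forests_split natrD addrC addKr factS natrM.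
rewrite invfM mulrA; apply/andP; split; rewrite ler_pM2r ?invr_gt0 //.
  by rewrite ler_pdivlMr ?ltr0n // -natrM ler_nat mulnC card_without_isolated_le.
rewrite ler_pdivrMr ?ltr0n // -natrD -card_forests_split -natrM ler_nat mulnC.
exact: card_with_isolated_le.
Qed.

Lemma not_unlabeled_law (R : realType) :
  ~ unlabeled_zero_one_law R finite_labeled_unary_forest.
Proof.
move=> /(_ isolated_sentence).
pose a n : R := #|[set cls r | r in forests n]%SET|%:R.
pose h n : R := #|[set cls r | r in with_isolated n]%SET|%:R.
rewrite (_ : unlabeled_fraction R _ _ = fun n => h n / a n); last first.
  (* The denominators agree by conversion, as [equivalence_partition] is by definition the image of
     the forests under [cls]. *)
  by apply/funext => n; rewrite /unlabeled_fraction classes_isolated.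
apply: ratio_not_zero_or_one => n.
- by rewrite ltr0n card_gt0 imset_eq0 forests_neq0.
(* There are at least (n+1)! times [2 ^ n] forests, and at most (n+1)! of them in each class. *)
- rewrite -natrX ler_nat -(leq_pmul2l (fact_gt0 n.+1)).
  exact: leq_trans (card_forests_ge n) (card_forests_le n.+1).
- by rewrite -natrX ler_nat card_classes_le.
apply/andP; split; last by rewrite ler_nat card_classes_with_isolated_le.
rewrite lerBlDr -natrD ler_nat addnC; apply: leq_trans (card_classes_split n) _.
by rewrite leq_add2l card_classes_without_isolated_le.
Qed.

Theorem theorem6 (R : realType) :
  geometric_zero_one_law R finite_labeled_unary_forest /\
  ~ labeled_zero_one_law R finite_labeled_unary_forest /\
  ~ unlabeled_zero_one_law R finite_labeled_unary_forest.
Proof.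
split; first exact: geometric_law.
by split; [exact: not_labeled_law|exact: not_unlabeled_law].
Qed.
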